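(* Let $N\ge 3$ be an odd integer, let $\Sigma_{0,2}$ be the annulus, and let $S=\chi(\Sigma_{0,2})-\{0\}$. Then $S^{-1}K_N(\Sigma_{0,2})$, equipped with the normalized trace $Tr:S^{-1}K_N(\Sigma_{0,2})\to S^{-1}\chi(\Sigma_{0,2})$, is a Frobenius algebra over $S^{-1}\chi(\Sigma_{0,2})$, the function field of the $SL_2\mathbb{C}$-character variety of $\pi_1(\Sigma_{0,2})$.
   Context: Let $A=e^{\pi i/N}$. For a compact oriented surface $F$, the Kauffman bracket skein algebra $K_N(F)$ is the quotient of the complex vector space with basis the isotopy classes of framed links (disjoint unions of oriented annuli, including the empty link) in $F\times[0,1]$ by the relations $L=A\,L_0+A^{-1}L_\infty$ (where $L,L_0,L_\infty$ agree outside a ball, in which $L$ is a crossing and $L_0$, $L_\infty$ are its two smoothings, $L_0$ being the one joining the regions swept out by rotating the over-strand counterclockwise) and $\bigcirc\cup L=-(A^2+A^{-2})L$. The product $\alpha*\beta$ stacks $\alpha$ over $\beta$. $K_1(F)$ is defined in the same way with $A=-1$. The Tchebychev polynomials are $T_0(x)=2$, $T_1(x)=x$, $T_{n+1}(x)=xT_n(x)-T_{n-1}(x)$. The threading map $\tau:K_1(F)\to K_N(F)$, which threads every component of a framed link with $T_N$, is a well-defined injective algebra homomorphism with central image (Bonahon–Wong). Write $\chi(F)=\tau(K_1(F))$; it is an integral domain canonically isomorphic to the coordinate ring of the $SL_2\mathbb{C}$-character variety of $\pi_1(F)$. For the annulus, $K_N(\Sigma_{0,2})\cong\mathbb{C}[x]$,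 with $x$ the core curve with blackboard framing, and $\chi(\Sigma_{0,2})$ is the span of the $T_{Na}(x)$, $a\ge 0$. With $S=\chi(F)-\{0\}$, $S^{-1}\chi(F)$ is the field of fractions of $\chi(F)$ and $S^{-1}K_N(F)$ is the localization, an algebra over $S^{-1}\chi(F)$. If it has finite dimension $k$, the normalized trace is $Tr(\alpha)=\frac1k$ times the trace of left multiplication by $\alpha$. A Frobenius algebra over a field $k$ is a finite dimensional $k$-algebra $B$ equipped with a $k$-linear functional $\epsilon:B\to k$ having no nontrivial principal ideals in its kernel; equivalently, for every $a\ne0$ in $B$ there is $b\in B$ with $\epsilon(ab)\neq0$. *)

(* Defs.v *)
From HB Require Import structures.
From mathcomp Require Import all_boot all_order all_algebra.
From mathcomp Require Import generic_quotient ring_quotient.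
From mathcomp Require Import finmap monalg.
From mathcomp Require Import mathcomp_extra boolp reals trigo.
From mathcomp Require Import complex zify.

#[local] Set Warnings "-redundant-canonical-projection,-projection-no-head-constant".
Set Implicit Arguments.
Unset Strict Implicit.
Unset Printing Implicit Defensive.

Import Order.TTheory GRing.Theory Num.Theory.
Local Open Scope ring_scope.
Local Open Scope quotient_scope.

(** Give the annulus the coordinates (r, theta), oriented by (d/dr, d/dtheta).
  A link diagram in general position with respect to the angle theta is read
  off, as theta makes one full turn, as a cyclic word in local minima (Cup),
  local maxima (Cap) and crossings; strands are numbered from 0 by increasing
  r.  Such a diagram is cut open at theta = 0, where it has [n] strands; it is
  then the closure of a tangle with [n] inputs and [n] outputs.  The framing
  is the blackboard framing.

  With theta drawn upwards and r drawn to the right, [(p, i)] acts on the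
  strands i and i+1: [Over] (resp. [Under]) is the crossing in which the
  strand going from position i to position i+1 passes over (resp. under) the
  strand going from i+1 to i. *)

Inductive piece := Cup | Cap | Over | Under.

Definition piece_code (p : piece) : bool * bool :=
  match p with
  | Cup => (false, false) | Cap => (false, true)
  | Over => (true, false) | Under => (true, true)
  end.

Definition piece_decode (b : bool * bool) : piece :=
  match b with
  | (false, false) => Cup | (false, true) => Cap
  | (true, false) => Over | (true, true) => Under
  end.

Lemma piece_codeK : cancel piece_code piece_decode.
Proof. by case. Qed.

HB.instance Definition _ := Countable.copy piece (can_type piece_codeK).

Definition tile : Type := piece * nat.
Definition word : Type := seq tile.

Definition fan_in (p : piece) : nat := if p is Cup then 0%N else 2%N.
Definition fan_out (p : piece) : nat := if p is Cap then 0%N else 2%N.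

Definition step (t : tile) (n : nat) : option nat :=
  if (t.2 + fan_in t.1 <= n)%N then Some (n - fan_in t.1 + fan_out t.1)%N
  else None.

(* [run n w = Some m]: the word [w] is a tangle from n to m strands. *)
Fixpoint run (n : nat) (w : word) : option nat :=
  if w is t :: w' then obind (run^~ w') (step t n) else Some n.

Definition is_closed (x : nat * word) : bool := run x.1 x.2 == Some x.1.

Record diagram := Diagram { cut : nat * word; _ : is_closed cut }.

HB.instance Definition _ := [isSub for cut].
HB.instance Definition _ := [Choice of diagram by <:].

Definition shift (k : nat) (w : word) : word :=
  [seq (t.1, k + t.2)%N | t <- w].

Lemma run_cat n w1 w2 : run n (w1 ++ w2) = obind (run^~ w2) (run n w1).
Proof. by elim: w1 n => [//|t w1 IH] n /=; case: (step t n). Qed.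

Lemma step_shift k t n :
  step (t.1, k + t.2)%N (k + n) = omap (addn k) (step t n).
Proof.
rewrite /step /= -addnA leq_add2l; case: ifP => //= h.
by rewrite -addnBA ?addnA // (leq_trans (leq_addl _ _) h).
Qed.

Lemma run_shift k w n : run (k + n) (shift k w) = omap (addn k) (run n w).
Proof.
elim: w n => [//|t w IH] n /=.
by rewrite step_shift; case: (step t n) => //= m; apply: IH.
Qed.

Lemma step_widen k t n m : step t n = Some m -> step t (n + k) = Some (m + k)%N.
Proof.
rewrite /step; case: ifP => // h [<-].
rewrite (leq_trans h (leq_addr _ _)) -addnBAC ?(leq_trans (leq_addl _ _) h) //.
by rewrite addnAC.
Qed.

Lemma run_widen k w n m : run n w = Some m -> run (n + k) w = Some (m + k)%N.
Proof.
elim: w n => [|t w IH] n /=; first by move=> [->].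
by case E: (step t n) => [p|] //= /IH; rewrite (step_widen k E).
Qed.

(** Product of diagrams.  To stack [x] over [y], isotope [x] to the inner half
  and [y] to the outer half of the annulus: the result projects to the
  juxtaposition of the two diagrams. *)

Definition juxt_cut (x y : nat * word) : nat * word :=
  ((x.1 + y.1)%N, x.2 ++ shift x.1 y.2).

Lemma juxt_closed (D E : diagram) : is_closed (juxt_cut (cut D) (cut E)).
Proof.
case: D E => [[n w] /= /eqP hw] [[m v] /= /eqP hv].
by apply/eqP; rewrite /= run_cat (run_widen m hw) /= run_shift hv.
Qed.

Definition juxt (D E : diagram) : diagram := Diagram (juxt_closed D E).

Definition empty_link : diagram := @Diagram (0%N, [::]) (eqxx _).

Lemma shiftD a b w : shift (a + b) w = shift a (shift b w).
Proof.
by rewrite /shift -map_comp; apply: eq_map => t /=; rewrite addnA.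
Qed.

Lemma shift0 w : shift 0 w = w.
Proof. by rewrite /shift -[RHS]map_id; apply: eq_map => -[]. Qed.

Lemma shift_cat k v w : shift k (v ++ w) = shift k v ++ shift k w.
Proof. exact: map_cat. Qed.

Lemma juxtA : associative juxt.
Proof.
move=> [[n u] ?] [[m v] ?] [[p w] ?]; apply: val_inj; rewrite /= /juxt_cut /=.
by rewrite addnA shiftD shift_cat catA.
Qed.

Lemma juxt0D : left_id empty_link juxt.
Proof. by move=> [[n u] ?]; apply: val_inj; rewrite /= /juxt_cut /= shift0. Qed.

Lemma juxtD0 : right_id empty_link juxt.
Proof.
by move=> [[n u] ?]; apply: val_inj; rewrite /= /juxt_cut /= addn0 cats0.
Qed.

Lemma juxt_eq0 D E : juxt D E = empty_link -> D = empty_link /\ E = empty_link.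
Proof.
case: D E => [[n u] hu] [[m v] hv] /(congr1 cut) [].
move=> /eqP; rewrite addn_eq0 => /andP[/eqP n0 /eqP m0].
case: u hu => // hu; case: v hv => // hv _.
by subst n m; split; apply: val_inj.
Qed.

HB.instance Definition _ := Choice_isMonomialDef.Build diagram
  juxtA juxt0D juxtD0 juxt_eq0.

(** Isotopy.  [local_move] lists the elementary planar isotopies and the framed
  Reidemeister moves; together with the change of the cutting ray they
  generate isotopy of framed links in (annulus) x [0,1].  [move_far] slides
  past one another two pieces acting on disjoint sets of strands. *)

Inductive local_move : word -> word -> Prop :=
| move_far p q i d :
    local_move [:: (q, i + fan_in p + d)%N; (p, i)]
               [:: (p, i); (q, i + fan_out p + d)%N]
| move_zigzag_l i : local_move [:: (Cup, i); (Cap, i.+1)] [::]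
| move_zigzag_r i : local_move [:: (Cup, i.+1); (Cap, i)] [::]
| move_cup_over i :
    local_move [:: (Cup, i); (Over, i.+1)] [:: (Cup, i.+1); (Under, i)]
| move_cup_under i :
    local_move [:: (Cup, i); (Under, i.+1)] [:: (Cup, i.+1); (Over, i)]
| move_cap_over i :
    local_move [:: (Over, i.+1); (Cap, i)] [:: (Under, i); (Cap, i.+1)]
| move_cap_under i :
    local_move [:: (Under, i.+1); (Cap, i)] [:: (Over, i); (Cap, i.+1)]
(* framed Reidemeister I: kinks of the same sign on either side agree *)
| move_R1_over i :
    local_move [:: (Cup, i.+1); (Over, i); (Cap, i.+1)]
               [:: (Cup, i); (Over, i.+1); (Cap, i)]
| move_R1_under i :
    local_move [:: (Cup, i.+1); (Under, i); (Cap, i.+1)]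
               [:: (Cup, i); (Under, i.+1); (Cap, i)]
| move_R2_over i : local_move [:: (Over, i); (Under, i)] [::]
| move_R2_under i : local_move [:: (Under, i); (Over, i)] [::]
| move_R3 i :
    local_move [:: (Over, i); (Over, i.+1); (Over, i)]
               [:: (Over, i.+1); (Over, i); (Over, i.+1)].

Inductive isotopic : diagram -> diagram -> Prop :=
| isotopic_local D E n w1 u v w2 :
    local_move u v ->
    cut D = (n, w1 ++ u ++ w2) -> cut E = (n, w1 ++ v ++ w2) -> isotopic D E
| isotopic_turn D E n m w1 w2 :
    run n w1 = Some m ->
    cut D = (n, w1 ++ w2) -> cut E = (m, w2 ++ w1) -> isotopic D E
| isotopic_refl D : isotopic D D
| isotopic_sym D E : isotopic D E -> isotopic E D
| isotopic_trans D E G : isotopic D E -> isotopic E G -> isotopic D G.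

Lemma local_move_shift k u v :
  local_move u v -> local_move (shift k u) (shift k v).
Proof.
by case=> * /=; rewrite /shift /= ?addnS ?addnA; constructor.
Qed.

Inductive far_eq : word -> word -> Prop :=
| far_refl w : far_eq w w
| far_trans u v w : far_eq u v -> far_eq v w -> far_eq u w
| far_swap w1 w2 p q i d :
    far_eq (w1 ++ [:: (q, i + fan_in p + d)%N; (p, i)] ++ w2)
           (w1 ++ [:: (p, i); (q, i + fan_out p + d)%N] ++ w2).

Lemma far_run u v : far_eq u v -> forall n, run n u = run n v.
Proof.
elim=> [//|? ? ? _ h1 _ h2 n|w1 w2 p q i d n]; first by rewrite h1.
rewrite !run_cat; case: (run n w1) => //= k; rewrite /step /=.
by case: p; case: q; rewrite /=; repeat case: ifP => ? //=; try lia; congr (run _ w2); lia.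
Qed.

Lemma far_ctx a b u v : far_eq u v -> far_eq (a ++ u ++ b) (a ++ v ++ b).
Proof.
elim=> [w|? ? ? _ h1 _ h2|w1 w2 p q i d]; first exact: far_refl.
  exact: far_trans h1 h2.
rewrite -!catA !(catA a w1); exact: far_swap.
Qed.

Lemma far_tile t v n m : step t n = Some m ->
  far_eq (shift n v ++ [:: t]) (t :: shift m v).
Proof.
case: t => p i; rewrite /step /=; case: ifP => // h [<-].
elim: v => [|[q j] v IH] /=; first exact: far_refl.
have h1 := far_ctx [:: (q, n + j)%N] [::] IH.
rewrite /= !cats0 in h1; apply: far_trans h1 _.
have := far_swap [::] (shift (n - fan_in p + fan_out p) v)
          p q i (n - (i + fan_in p) + j).
rewrite /=.
have -> : (i + fan_in p + (n - (i + fan_in p) + j) = n + j)%N by lia.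
by have -> : (i + fan_out p + (n - (i + fan_in p) + j) =
              n - fan_in p + fan_out p + j)%N by lia.
Qed.

Lemma far_interchange u v n m : run n u = Some m ->
  far_eq (shift n v ++ u) (u ++ shift m v).
Proof.
elim: u n => [|t u IH] n /=; first by move=> [->]; rewrite cats0; apply: far_refl.
case E: (step t n) => [k|] //= /IH {}IH.
apply: (@far_trans _ (t :: shift k v ++ u)).
  by have := far_ctx [::] u (far_tile v E); rewrite /= -catA.
by have := far_ctx [:: t] [::] IH; rewrite /= !cats0.
Qed.

Lemma far_isotopic u v n D E :
  far_eq u v -> cut D = (n, u) -> cut E = (n, v) -> isotopic D E.
Proof.
move=> h; elim: h n D E => [w|u1 v1 w1 _ IH1 h2 IH2|w1 w2 p q i d] n D E hD hE.
- have -> : D = E by apply: val_inj; rewrite /= hD hE.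
  exact: isotopic_refl.
- have hv : is_closed (n, v1).
    by have := valP E; rewrite /= hE /is_closed /= (far_run h2).
  apply: (@isotopic_trans D (Diagram hv) E); first exact: IH1 hD _.
  exact: IH2 hE.
- exact: isotopic_local (move_far p q i d) hD hE.
Qed.

Lemma isotopic_juxtl E D D' : isotopic D D' -> isotopic (juxt E D) (juxt E D').
Proof.
elim=> {D D'}.
- move=> D D' n w1 u v w2 h hD hD'.
  apply: (@isotopic_local _ _ ((cut E).1 + n)%N
    ((cut E).2 ++ shift (cut E).1 w1) (shift (cut E).1 u)
    (shift (cut E).1 v) (shift (cut E).1 w2)).
  + exact: local_move_shift.
  + by rewrite /= /juxt_cut hD /= !shift_cat !catA.
  + by rewrite /= /juxt_cut hD' /= !shift_cat !catA.
- move=> D D' n m w1 w2 h hD hD'.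
  case cE : (cut E) => [e w].
  have hE : run e w = Some e by have /eqP := valP E; rewrite /= cE.
  have hw : run (e + n) (w ++ shift e w1) = Some (e + m)%N.
    by rewrite run_cat (run_widen n hE) /= run_shift h.
  have h2 : run m w2 = Some n.
    by have /eqP := valP D; rewrite /= hD /= run_cat h.
  have hG : is_closed ((e + m)%N, shift e w2 ++ w ++ shift e w1).
    by rewrite /is_closed /= run_cat run_shift h2 /= hw.
  apply: (@isotopic_trans _ (Diagram hG)).
    apply: (isotopic_turn hw) => //.
    by rewrite /= /juxt_cut hD cE /= !shift_cat !catA.
  apply: (@far_isotopic (shift e w2 ++ w ++ shift e w1)
            (w ++ shift e w2 ++ shift e w1) (e + m)%N) => //.
    by have := far_ctx [::] (shift e w1) (far_interchange w2 hE);
      rewrite /= -!catA.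
  by rewrite /= /juxt_cut hD' cE /= shift_cat.
- by move=> D; apply: isotopic_refl.
- by move=> D D' _; apply: isotopic_sym.
- by move=> D D' D'' _ h1 _; apply: isotopic_trans.
Qed.

Lemma isotopic_juxtr E D D' : isotopic D D' -> isotopic (juxt D E) (juxt D' E).
Proof.
elim=> {D D'}.
- move=> D D' n w1 u v w2 h hD hD'.
  apply: (@isotopic_local _ _ (n + (cut E).1)%N w1 u v
    (w2 ++ shift n (cut E).2)) => //.
  + by rewrite /= /juxt_cut hD /= -!catA.
  + by rewrite /= /juxt_cut hD' /= -!catA.
- move=> D D' n m w1 w2 h hD hD'.
  case cE : (cut E) => [e w].
  have hE : run e w = Some e by have /eqP := valP E; rewrite /= cE.
  have h2 : run m w2 = Some n.
    by have /eqP := valP D; rewrite /= hD /= run_cat h.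
  have hG : is_closed ((m + e)%N, w2 ++ shift n w ++ w1).
    rewrite /is_closed /= !run_cat (run_widen e h2) /= run_cat run_shift hE /=.
    by rewrite (run_widen e h).
  apply: (@isotopic_trans _ (Diagram hG)).
    apply: (@isotopic_turn _ _ _ _ w1 (w2 ++ shift n w) (run_widen e h));
      last by rewrite /= -catA.
    by rewrite /= /juxt_cut hD cE /= -catA.
  apply: (@far_isotopic (w2 ++ shift n w ++ w1)
            (w2 ++ w1 ++ shift m w) (m + e)%N) => //.
    by have := far_ctx w2 [::] (far_interchange w h); rewrite !cats0.
  by rewrite /= /juxt_cut hD' cE /= -catA.
- by move=> D; apply: isotopic_refl.
- by move=> D D' _; apply: isotopic_sym.
- by move=> D D' D'' _ h1 _; apply: isotopic_trans.
Qed.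

Section Skein.
Variables (C : fieldType) (A : C).

(* Rotating the over-strand of [Over] counterclockwise sweeps the top and
   bottom regions, so its A-smoothing is a pair of vertical strands; for
   [Under] it is the cap followed by the cup. *)
Inductive skein_null : {malg C[diagram]} -> Prop :=
| null_isotopic D E : isotopic D E -> skein_null (<< D >> - << E >>)
| null_over n w1 i w2 D D0 Doo :
    cut D = (n, w1 ++ (Over, i) :: w2) ->
    cut D0 = (n, w1 ++ w2) ->
    cut Doo = (n, w1 ++ [:: (Cap, i); (Cup, i)] ++ w2) ->
    skein_null (<< D >> - (A *: << D0 >> + A^-1 *: << Doo >>))
| null_under n w1 i w2 D D0 Doo :
    cut D = (n, w1 ++ (Under, i) :: w2) ->
    cut D0 = (n, w1 ++ [:: (Cap, i); (Cup, i)] ++ w2) ->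
    cut Doo = (n, w1 ++ w2) ->
    skein_null (<< D >> - (A *: << D0 >> + A^-1 *: << Doo >>))
| null_circle n w1 i w2 D E :
    cut D = (n, w1 ++ [:: (Cup, i); (Cap, i)] ++ w2) ->
    cut E = (n, w1 ++ w2) ->
    skein_null (<< D >> + (A ^+ 2 + A ^- 2) *: << E >>)
| null_0 : skein_null 0
| null_D g h : skein_null g -> skein_null h -> skein_null (g + h)
| null_Z c g : skein_null g -> skein_null (c *: g).

Lemma malgUM (D E : diagram) :
  << D >> * << E >> = << juxt D E >> :> {malg C[diagram]}.
Proof. by rewrite malgM_def fgmulUU mulr1. Qed.

Lemma malg_scaleAr (c : C) (g h : {malg C[diagram]}) :
  g * (c *: h) = c *: (g * h).
Proof.
apply/malgP => k; rewrite mcoeffZ (mcoeffMlw _ (fsubset_refl _) (msuppZ_le c h)).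
rewrite mcoeffMl mulr_sumr; apply: eq_bigr => D _.
rewrite mulr_sumr; apply: eq_bigr => E _.
by rewrite mcoeffZ mulrCA mulrnAr.
Qed.

Lemma null_mull E g : skein_null g -> skein_null (<< E >> * g).
Proof.
elim=> {g}.
- move=> D D' h; rewrite mulrBr !malgUM.
  exact/null_isotopic/isotopic_juxtl.
- move=> n w1 i w2 D D0 Doo h h0 hoo.
  rewrite mulrBr mulrDr !malg_scaleAr !malgUM.
  apply: (@null_over ((cut E).1 + n)%N ((cut E).2 ++ shift (cut E).1 w1)
     ((cut E).1 + i)%N (shift (cut E).1 w2));
    by rewrite /= /juxt_cut ?h ?h0 ?hoo /= !shift_cat -!catA.
- move=> n w1 i w2 D D0 Doo h h0 hoo.
  rewrite mulrBr mulrDr !malg_scaleAr !malgUM.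
  apply: (@null_under ((cut E).1 + n)%N ((cut E).2 ++ shift (cut E).1 w1)
     ((cut E).1 + i)%N (shift (cut E).1 w2));
    by rewrite /= /juxt_cut ?h ?h0 ?hoo /= !shift_cat -!catA.
- move=> n w1 i w2 D D0 h h0.
  rewrite mulrDr !malg_scaleAr !malgUM.
  apply: (@null_circle ((cut E).1 + n)%N ((cut E).2 ++ shift (cut E).1 w1)
     ((cut E).1 + i)%N (shift (cut E).1 w2));
    by rewrite /= /juxt_cut ?h ?h0 /= !shift_cat -!catA.
- by rewrite mulr0; apply: null_0.
- by move=> g h _ ? _ ?; rewrite mulrDr; apply: null_D.
- by move=> c g _ ?; rewrite malg_scaleAr; apply: null_Z.
Qed.

Lemma null_mulr E g : skein_null g -> skein_null (g * << E >>).
Proof.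
elim=> {g}.
- move=> D D' h; rewrite mulrBl !malgUM.
  exact/null_isotopic/isotopic_juxtr.
- move=> n w1 i w2 D D0 Doo h h0 hoo.
  rewrite mulrBl mulrDl -!scalerAl !malgUM.
  apply: (@null_over (n + (cut E).1)%N w1 i (w2 ++ shift n (cut E).2));
    by rewrite /= /juxt_cut ?h ?h0 ?hoo /= -!catA.
- move=> n w1 i w2 D D0 Doo h h0 hoo.
  rewrite mulrBl mulrDl -!scalerAl !malgUM.
  apply: (@null_under (n + (cut E).1)%N w1 i (w2 ++ shift n (cut E).2));
    by rewrite /= /juxt_cut ?h ?h0 ?hoo /= -!catA.
- move=> n w1 i w2 D D0 h h0.
  rewrite mulrDl -!scalerAl !malgUM.
  apply: (@null_circle (n + (cut E).1)%N w1 i (w2 ++ shift n (cut E).2));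
    by rewrite /= /juxt_cut ?h ?h0 /= -!catA.
- by rewrite mul0r; apply: null_0.
- by move=> g h _ ? _ ?; rewrite mulrDl; apply: null_D.
- by move=> c g _ ?; rewrite -scalerAl; apply: null_Z.
Qed.

Lemma null_sum (I : Type) (r : seq I) (F : I -> {malg C[diagram]}) :
  (forall i, skein_null (F i)) -> skein_null (\sum_(i <- r) F i).
Proof. by move=> h; apply: big_ind => //; [apply: null_0 | apply: null_D]. Qed.

Lemma malgUZ (c : C) (D : diagram) : << c *g D >> = c *: << D >>.
Proof. by apply/malgP=> k; rewrite mcoeffZ !mcoeffU mulrnAr mulr1. Qed.

Lemma null_mulgl h g : skein_null g -> skein_null (h * g).
Proof.
move=> hg; rewrite [h]monalgE mulr_suml; apply: null_sum => D.
by rewrite malgUZ -scalerAl; apply/null_Z/null_mull.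
Qed.

Lemma null_mulgr h g : skein_null g -> skein_null (g * h).
Proof.
move=> hg; rewrite [h]monalgE mulr_sumr; apply: null_sum => D.
by rewrite malgUZ malg_scaleAr; apply/null_Z/null_mulr.
Qed.

Definition skein_nullb : {pred {malg C[diagram]}} := fun g => `[< skein_null g >].

Lemma skein_nullP g : reflect (skein_null g) (g \in skein_nullb).
Proof. exact: asboolP. Qed.

Lemma skein_null_zmod : zmod_closed skein_nullb.
Proof.
split; first by apply/skein_nullP; apply: null_0.
move=> g h /skein_nullP hg /skein_nullP hh; apply/skein_nullP.
by rewrite -scaleN1r; apply/null_D/null_Z.
Qed.

HB.instance Definition _ :=
  GRing.isZmodClosed.Build {malg C[diagram]} skein_nullb skein_null_zmod.

Definition skein : Type := Quotient.quot skein_nullb.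
HB.instance Definition _ := GRing.Zmodule.on skein.

Definition skein_class (g : {malg C[diagram]}) : skein := \pi_(Quotient.quot skein_nullb) g.

Lemma skein_class_surj (x : skein) : exists g, skein_class g = x.
Proof. by exists (repr x); rewrite /skein_class reprK. Qed.

Lemma skein_classP g h :
  skein_class g = skein_class h <-> skein_null (g - h).
Proof.
split=> [/eqP|/skein_nullP].
  by rewrite /skein_class -Quotient.idealrBE => /skein_nullP.
by rewrite Quotient.idealrBE => /eqP.
Qed.

Lemma skein_classB : {morph skein_class : g h / g - h}.
Proof. exact: raddfB. Qed.

Lemma skein_classD : {morph skein_class : g h / g + h}.
Proof. exact: raddfD. Qed.

Lemma repr_null g : skein_null (repr (skein_class g) - g).
Proof. by apply/skein_classP; rewrite /skein_class reprK. Qed.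

Definition skein_one : skein := skein_class 1.
Definition skein_mul (x y : skein) : skein := skein_class (repr x * repr y).
Definition skein_scale (c : C) (x : skein) : skein := skein_class (c *: repr x).

Lemma skein_classM g h :
  skein_mul (skein_class g) (skein_class h) = skein_class (g * h).
Proof.
apply/skein_classP; set x := repr _; set y := repr _.
have -> : x * y - g * h = (x - g) * y + g * (y - h).
  by rewrite mulrBl mulrBr addrA subrK.
by apply: null_D; [apply: null_mulgr | apply: null_mulgl]; apply: repr_null.
Qed.

Lemma skein_classZ c g :
  skein_scale c (skein_class g) = skein_class (c *: g).
Proof. by apply/skein_classP; rewrite -scalerBr; apply/null_Z/repr_null. Qed.

Lemma skein_mulA : associative skein_mul.
Proof.
move=> x y z; have [g <-] := skein_class_surj x.
have [h <-] := skein_class_surj y; have [k <-] := skein_class_surj z.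
by rewrite !skein_classM mulrA.
Qed.

Lemma skein_mul1l : left_id skein_one skein_mul.
Proof.
by move=> x; have [g <-] := skein_class_surj x; rewrite skein_classM mul1r.
Qed.

Lemma skein_mul1r : right_id skein_one skein_mul.
Proof.
by move=> x; have [g <-] := skein_class_surj x; rewrite skein_classM mulr1.
Qed.

Lemma skein_mulDl : left_distributive skein_mul +%R.
Proof.
move=> x y z; have [g <-] := skein_class_surj x.
have [h <-] := skein_class_surj y; have [k <-] := skein_class_surj z.
by rewrite -skein_classD !skein_classM -skein_classD mulrDl.
Qed.

Lemma skein_mulDr : right_distributive skein_mul +%R.
Proof.
move=> x y z; have [g <-] := skein_class_surj x.
have [h <-] := skein_class_surj y; have [k <-] := skein_class_surj z.
by rewrite -skein_classD !skein_classM -skein_classD mulrDr.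
Qed.

HB.instance Definition _ := GRing.Zmodule_isPzRing.Build skein
  skein_mulA skein_mul1l skein_mul1r skein_mulDl skein_mulDr.

Lemma skein_scaleA a b x : skein_scale a (skein_scale b x) = skein_scale (a * b) x.
Proof.
by have [g <-] := skein_class_surj x; rewrite !skein_classZ scalerA.
Qed.

Lemma skein_scale1 : left_id 1 skein_scale.
Proof.
by move=> x; have [g <-] := skein_class_surj x; rewrite skein_classZ scale1r.
Qed.

Lemma skein_scaleDr : right_distributive skein_scale +%R.
Proof.
move=> c x y; have [g <-] := skein_class_surj x.
have [h <-] := skein_class_surj y.
by rewrite -skein_classD !skein_classZ -skein_classD scalerDr.
Qed.

Lemma skein_scaleDl x : {morph skein_scale^~ x : a b / a + b}.
Proof.
move=> a b /=; have [g <-] := skein_class_surj x.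
by rewrite !skein_classZ -skein_classD scalerDl.
Qed.

HB.instance Definition _ := GRing.Zmodule_isLmodule.Build C skein
  skein_scaleA skein_scale1 skein_scaleDr skein_scaleDl.

Definition link_class (D : diagram) : skein := skein_class << D >>.

End Skein.

(** The arcs of a diagram are the strands entering at the bottom, labelled
  0, ..., n-1, and one arc for each cup, labelled from n on in the order of
  occurrence.  [labels] holds the arcs met along a horizontal level. *)

Definition relabel (fresh : nat) (labels : seq nat) (t : tile) : seq nat :=
  let: (p, i) := t in
  match p with
  | Cup => take i labels ++ [:: fresh; fresh] ++ drop i labels
  | Cap => take i labels ++ drop i.+2 labels
  | Over | Under =>
      take i labels ++ [:: nth 0%N labels i.+1; nth 0%N labels i]
                    ++ drop i.+2 labels
  end.

Definition next_label (fresh : nat) (t : tile) : nat := (fresh + (t.1 == Cup))%N.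

Fixpoint joins (fresh : nat) (labels : seq nat) (w : word) : seq (nat * nat) :=
  if w is t :: w' then
    (if t.1 is Cap then [:: (nth 0%N labels t.2, nth 0%N labels t.2.+1)]
     else [::])
    ++ joins (next_label fresh t) (relabel fresh labels t) w'
  else zip (iota 0 (size labels)) labels.

Definition arcs (D : diagram) : nat :=
  ((cut D).1 + count (fun t : tile => t.1 == Cup) (cut D).2)%N.

Definition joined (D : diagram) : rel 'I_(arcs D) :=
  fun a b => let js := joins (cut D).1 (iota 0 (cut D).1) (cut D).2 in
    ((a : nat, b : nat) \in js) || ((b : nat, a : nat) \in js).

(* [cable c] replaces the arc [a] by [c a] parallel copies of it. *)
Definition cable_tile (c : nat -> nat) (fresh : nat) (labels : seq nat)
    (t : tile) : word :=
  let: (p, i) := t in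
  let o := sumn [seq c l | l <- take i labels] in
  let j := c (nth 0%N labels i) in
  let k := c (nth 0%N labels i.+1) in
  match p with
  | Cup => [seq (Cup, o + s)%N | s <- iota 0 (c fresh)]
  | Cap => [seq (Cap, o + s)%N | s <- rev (iota 0 j)]
  | Over | Under => [seq (p, o + s + r)%N | s <- rev (iota 0 j), r <- iota 0 k]
  end.

Fixpoint cable (c : nat -> nat) (fresh : nat) (labels : seq nat) (w : word) :
    word :=
  if w is t :: w' then
    cable_tile c fresh labels t
    ++ cable c (next_label fresh t) (relabel fresh labels t) w'
  else [::].

Definition cable_cut (D : diagram) (c : nat -> nat) : nat * word :=
  (sumn [seq c l | l <- iota 0 (cut D).1],
   cable c (cut D).1 (iota 0 (cut D).1) (cut D).2).

Lemma run_cups a o s k : (o + s <= a)%N ->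
  run a [seq (Cup, o + r)%N | r <- iota s k] = Some (a + k.*2)%N.
Proof.
elim: k a s => [|k IH] a s h /=; first by rewrite addn0.
rewrite /step /= addn0 h /= IH; last by lia.
by congr Some; lia.
Qed.

Lemma run_caps a o j : (o + j.*2 <= a)%N ->
  run a [seq (Cap, o + r)%N | r <- rev (iota 0 j)] = Some (a - j.*2)%N.
Proof.
elim: j a => [|j IH] a h; first by rewrite /= subn0.
rewrite -[j.+1]addn1 iotaD rev_cat /= /step /=.
have -> : (o + (0 + j) + 2 <= a)%N by lia.
by rewrite /= IH; [congr Some; lia | lia].
Qed.

Lemma run_crossings a w :
  all (fun t : tile => (t.1 \in [:: Over; Under]) && (t.2 + 2 <= a)%N) w ->
  run a w = Some a.
Proof.
elim: w => [//|[p i] w IH] /= /andP[/andP[hp hi] /IH hw].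
by move: hp; rewrite !inE => /orP[] /eqP ->; rewrite /step /= hi /=;
  have -> : (a - 2 + 2 = a)%N by lia.
Qed.

Lemma sumn_split2 (c : nat -> nat) i ls : (i + 2 <= size ls)%N ->
  sumn [seq c l | l <- ls] =
  (sumn [seq c l | l <- take i ls] + c (nth 0 ls i) + c (nth 0 ls i.+1)
   + sumn [seq c l | l <- drop i.+2 ls])%N.
Proof.
move=> h; rewrite -{1}(cat_take_drop i ls) map_cat sumn_cat.
rewrite (drop_nth 0%N) ?(drop_nth 0%N (n := i.+1)) /=; lia.
Qed.

Lemma run_cable_tile c fresh ls t m :
  step t (size ls) = Some m ->
  (t.1 = Cap -> c (nth 0 ls t.2) = c (nth 0 ls t.2.+1))%N ->
  size (relabel fresh ls t) = m /\
  run (sumn [seq c l | l <- ls]) (cable_tile c fresh ls t) =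
    Some (sumn [seq c l | l <- relabel fresh ls t]).
Proof.
case: t => p i; rewrite /step /=; case: ifP => // h [<-] hc.
case: p h hc => /= h hc.
- rewrite !(size_cat, size_take, map_cat, sumn_cat) /= ?size_drop.
  split; first by case: ltnP; lia.
  rewrite run_cups.
    rewrite -{1}(cat_take_drop i ls) map_cat sumn_cat; congr Some; lia.
  by rewrite -[in leqRHS](cat_take_drop i ls) map_cat sumn_cat; lia.
- rewrite !(size_cat, size_take, map_cat, sumn_cat) /= ?size_drop.
  split; first by case: ltnP; lia.
  rewrite (sumn_split2 c h) -hc // run_caps; [congr Some; lia | lia].
- rewrite !(size_cat, size_take, map_cat, sumn_cat) /= ?size_drop.
  split; first by case: ltnP; lia.
  rewrite (sumn_split2 c h) run_crossings; first by congr Some; lia.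
  apply/allP => t /allpairsP[[s r] /= [hs hr ->]].
  by move: hs hr; rewrite mem_rev !mem_iota !inE /=; lia.
- rewrite !(size_cat, size_take, map_cat, sumn_cat) /= ?size_drop.
  split; first by case: ltnP; lia.
  rewrite (sumn_split2 c h) run_crossings; first by congr Some; lia.
  apply/allP => t /allpairsP[[s r] /= [hs hr ->]].
  by move: hs hr; rewrite mem_rev !mem_iota !inE /=; lia.
Qed.

Lemma run_cable c fresh ls w m :
  run (size ls) w = Some m ->
  (forall a b, (a, b) \in joins fresh ls w -> c a = c b) ->
  run (sumn [seq c l | l <- ls]) (cable c fresh ls w) =
    Some (sumn [seq c l | l <- iota 0 m]).
Proof.
elim: w fresh ls => [|t w IH] fresh ls /=.
  case=> <- h; congr (Some (sumn _)).
  elim: ls (0%N) h => [//|l ls IH] s h /=.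
  rewrite (h s l) ?inE ?eqxx // (IH s.+1) // => a b hab.
  by apply: h; rewrite inE hab orbT.
case E: (step t (size ls)) => [k|] //= hr hj.
have [|hs hrun] := @run_cable_tile c fresh ls t k E.
  by move=> ht; apply: hj; rewrite ht /= inE eqxx.
rewrite run_cat hrun /= IH ?hs // => a b hab.
by apply: hj; rewrite mem_cat hab orbT.
Qed.

Lemma cable_closed D c :
  (forall a b, (a, b) \in joins (cut D).1 (iota 0 (cut D).1) (cut D).2 ->
     c a = c b) ->
  is_closed (cable_cut D c).
Proof.
move=> h; apply/eqP/run_cable => //.
by rewrite size_iota; have /eqP := valP D.
Qed.

Lemma joins_bound fresh ls w m M :
  run (size ls) w = Some m -> (m <= M)%N -> all (ltn^~ fresh) ls ->
  (fresh + count (fun t : tile => t.1 == Cup) w <= M)%N ->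
  forall a b, (a, b) \in joins fresh ls w -> (a < M)%N /\ (b < M)%N.
Proof.
elim: w fresh ls => [|t w IH] fresh ls /=.
  case=> <- hm /allP hl hf a b hab.
  have ha : a \in iota 0 (size ls).
    rewrite -(@unzip1_zip _ _ (iota 0 (size ls)) ls) ?size_iota //.
    exact: (map_f fst hab).
  have hb : b \in ls.
    rewrite -(@unzip2_zip _ _ (iota 0 (size ls)) ls) ?size_iota //.
    exact: (map_f snd hab).
  by move: ha (hl _ hb); rewrite mem_iota /=; lia.
case E: (step t (size ls)) => [k|] //= hr hm hl hf a b.
have [hs _] := @run_cable_tile (fun=> 0%N) fresh ls t k E (fun=> erefl).
rewrite mem_cat => /orP[|hab]; last first.
  apply: (IH (next_label fresh t) (relabel fresh ls t)) hab => //.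
  - by rewrite hs.
  - have hl' i : all (ltn^~ (next_label fresh t)) (take i ls) &&
                 all (ltn^~ (next_label fresh t)) (drop i ls).
      rewrite -all_cat cat_take_drop; apply: sub_all hl => l /= hl.
      by rewrite (leq_trans hl) // leq_addr.
    have hn i : (i < size ls)%N -> (nth 0 ls i < next_label fresh t)%N.
      move=> hi; move/allP: hl => /(_ _ (mem_nth 0%N hi)) /= hl.
      by rewrite (leq_trans hl) // leq_addr.
    case: t E {hr hf hs IH} hl' hn => p i; rewrite /step /=; case: ifP => // h _.
    case: p h => /= h hl' hn; rewrite !all_cat /=.
    + by have /andP[-> ->] := hl' i; rewrite /next_label /= addn1 ltnSn.
    + by have /andP[-> _] := hl' i; have /andP[_ ->] := hl' i.+2.
    + have /andP[-> _] := hl' i; have /andP[_ ->] := hl' i.+2.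
      by rewrite !hn //; lia.
    + have /andP[-> _] := hl' i; have /andP[_ ->] := hl' i.+2.
      by rewrite !hn //; lia.
  - by rewrite /next_label -addnA.
case: t E hf {hr hs IH} => p i; rewrite /step /=; case: ifP => // h _.
case: p h => //= h hf; rewrite inE => /eqP[-> ->].
have hn j : (j < size ls)%N -> (nth 0 ls j < fresh)%N.
  by move=> hj; move/allP: hl => /(_ _ (mem_nth 0%N hj)).
have := hn i; have := hn i.+1; lia.
Qed.

Fixpoint chebyshev (C : fieldType) (n : nat) : {poly C} :=
  match n with
  | 0 => 2%:R%:P
  | 1 => 'X
  | (m.+1 as k).+1 => 'X * chebyshev C k - chebyshev C m
  end.

Section Threading.
Variables (C : fieldType) (A : C) (N : nat).

Local Notation coloring D := {ffun 'I_(arcs D) -> 'I_N.+1}.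

Definition component_coloring (D : diagram) (c : coloring D) : bool :=
  [forall a, forall b, joined a b ==> (c a == c b)].

Definition copies (D : diagram) (c : coloring D) : nat -> nat :=
  fun l => if insub l is Some a then nat_of_ord (c a) else 0%N.

(* The default value is not used: see [cut_cabling]. *)
Definition cabling (D : diagram) (c : coloring D) : diagram :=
  insubd empty_link (cable_cut D (copies c)).

Lemma cut_cabling (D : diagram) (c : coloring D) :
  component_coloring c -> cut (cabling c) = cable_cut D (copies c).
Proof.
move=> hc; rewrite /cabling val_insubd ifT //; apply: cable_closed => a b hab.
have hD : run (size (iota 0 (cut D).1)) (cut D).2 = Some (cut D).1.
  by rewrite size_iota; have /eqP := valP D.
have hl : all (ltn^~ (cut D).1) (iota 0 (cut D).1).
  by apply/allP => l; rewrite mem_iota.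
have [ha hb] := joins_bound hD (leq_addr _ _) hl (leqnn _) hab.
have := forallP (forallP hc (Ordinal ha)) (Ordinal hb).
rewrite /joined /= hab /= => /eqP h.
by rewrite /copies !insubT h.
Qed.

(* [roots] selects one arc in each component of the link.  As T_N has degree
   N, the component through [a], threaded with T_N, is the sum over
   k = c a <= N of the coefficient of x^k in T_N times k parallel copies. *)
Definition thread (D : diagram) : skein A :=
  \sum_(c : coloring D | component_coloring c)
    (\prod_(a | roots (@joined D) a) (chebyshev C N)`_(c a))
      *: link_class A (cabling c).

(* Image of the threading map tau : K_1 -> K_N.  K_1 is [skein (-1)], a
   quotient of {malg C[diagram]}; tau is induced on it by the linear extension
   of [thread], hence has the same image as that extension. *)
Definition chi (x : skein A) : Prop :=
  exists g : {malg C[diagram]}, x = \sum_(D <- msupp g) g@_D *: thread D.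

Definition chi_nonzero (x : skein A) : Prop := chi x /\ x <> 0.

End Threading.

(* [phi] exhibits B as S^{-1}K, for a set S of central elements. *)
Record is_localization (K B : pzRingType) (S : K -> Prop)
    (phi : {rmorphism K -> B}) : Prop := IsLocalization {
  loc_inv : forall s, S s -> exists u, phi s * u = 1 /\ u * phi s = 1;
  loc_frac : forall b, exists k s, S s /\ phi s * b = phi k;
  loc_eq0 : forall k, phi k = 0 -> exists s, S s /\ s * k = 0
}.

(* [psi], of which only the values on [chi] matter, exhibits F as the field
   of fractions of the subring [chi] of K. *)
Record is_fraction_field (K : pzRingType) (chi : K -> Prop) (F : fieldType)
    (psi : K -> F) : Prop := IsFractionField {
  frac_1 : psi 1 = 1;
  frac_D : forall x y, chi x -> chi y -> psi (x + y) = psi x + psi y;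
  frac_M : forall x y, chi x -> chi y -> psi (x * y) = psi x * psi y;
  frac_inj : forall x, chi x -> psi x = 0 -> x = 0;
  frac_surj : forall f, exists x y,
    [/\ chi x, chi y, y <> 0 & f = psi x / psi y]
}.

Section Frobenius.
Variables (F : fieldType) (B : algType F).

(* [v] and its inverse [r] are the coordinate maps of a basis of B. *)
Definition coordinates (k : nat) (v : B -> 'rV[F]_k) (r : 'rV[F]_k -> B) :
    Prop :=
  [/\ linear v, cancel v r & cancel r v].

Definition finite_dimensional : Prop :=
  exists (k : nat) (v : B -> 'rV[F]_k) (r : 'rV[F]_k -> B), coordinates v r.

Definition normalized_trace (k : nat) (v : B -> 'rV[F]_k) (r : 'rV[F]_k -> B)
    (a : B) : F :=
  k%:R^-1 * \tr (lin1_mx (fun u => v (a * r u))).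

(* The principal ideal a B is in the kernel of eps only if it is trivial. *)
Definition frobenius_algebra (eps : B -> F) : Prop :=
  [/\ finite_dimensional, scalar eps
    & forall a, (forall b, eps (a * b) = 0) -> a = 0].

End Frobenius.

Definition skein_root (R : realType) (N : nat) : R[i] :=
  (cos (pi / N%:R) +i* sin (pi / N%:R))%C.

(* Main.v *)
(** Smoothing crossings, then cancelling in each crossingless annular diagram a
  cup against the cap that follows it, shows that the powers of the core x span
  K_N; hence B is generated over F by the image X of x.  Threading the core
  gives T_N(x), so T_N(X) = t is a scalar.

  If t <> 2 and t <> -2 then T_N - t is separable, because
  T_N^2 - 4 = (x^2 - 4) U^2 and T_N' = N U.  Then B is a quotient of
  F[X]/(T_N - t), in which every element a divides an idempotent e with
  e a = a.  In characteristic 0 the trace of e is its rank, so it vanishes only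
  if e = 0, i.e. a = 0.

  Finally t is not 2 or -2: the relations preserve the number of strands
  modulo 2, so K_N is graded, with T_N(x) in odd degree (N is odd) and
  constants in even degree; T_N(x) = 2 would force 4 = 0 in K_N, which is
  nonzero since chi has a field of fractions. *)

Require Import Defs.
From HB Require Import structures.
From mathcomp Require Import all_boot all_order all_algebra.
From mathcomp Require Import separable finmap monalg boolp.
From mathcomp Require Import reals complex.
From mathcomp Require Import ring zify.

Set Implicit Arguments.
Unset Strict Implicit.
Unset Printing Implicit Defensive.

Import GRing.Theory.
Local Open Scope ring_scope.

(** * Traces of separable algebras *)

(** Write [E] as [C R] with [C] of full column rank and [R] of full row rank. Cancelling [C] and [R]
    in [C R C R = C R] leaves [R C = 1], and [C R] and [R C] have the same trace. *)
Lemma mxtrace_idempotent (F : fieldType) n (E : 'M[F]_n) :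
  E *m E = E -> \tr E = (\rank E)%:R.
Proof.
move=> EE; move: (mulmx_base E) (row_base_free E) (col_base_full E).
move: (col_base E) (row_base E) => C R CR freeR fullC.
rewrite -{1}CR mxtrace_mulC.
suff -> : R *m C = 1%:M by rewrite mxtrace1.
apply: (row_full_inj fullC); apply: (row_free_inj freeR) => /=.
by rewrite mulmx1 -!mulmxA CR mulmxA CR.
Qed.

(* With [g = gcd(p, q)] and [p = g u], the factors [g] and [u] are coprime, so
   [s q + w u = 1] for some [s] and [w]; moreover [p] divides [q u]. *)
Lemma separable_idempotent (F : fieldType) (B : algType F) (x : B)
    (p q : {poly F}) :
  separable_poly p -> horner_alg x p = 0 ->
  exists b, let e := horner_alg x q * b in
    e * e = e /\ e * horner_alg x q = horner_alg x q.
Proof.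
move=> sep_p px0; pose h := horner_alg x.
pose g := gcdp p q; have gp : g %| p by exact: dvdp_gcdl.
have gq : g %| q by exact: dvdp_gcdr.
pose u := p %/ g; have pE : u * g = p by exact: divpK.
have cop_ug : coprimep u g.
  by move: sep_p; rewrite -pE separable_mul => /and3P[].
(* A common divisor of [q] and [u] divides [p], hence [g], while [u] and [g] are coprime. *)
have cop_qu : coprimep q u.
  apply/coprimepP => d dq du; have /coprimepP/(_ d du) := cop_ug; apply.
  by rewrite dvdp_gcd dq -pE dvdp_mulr.
have /Bezout_eq1_coprimepP[[s w] /= sw1] := cop_qu.
have qu0 : h (q * u) = 0.
  by rewrite -(divpK gq) -mulrA (mulrC g) pE /h rmorphM /= px0 mulr0.
have hC a b : h a * h b = h b * h a by rewrite -!rmorphM /= mulrC.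
have key : h q * h s * h q = h q.
  rewrite hC -!rmorphM /=.
  have -> : s * q * q = (s * q + w * u) * q - w * (q * u) by ring.
  by rewrite sw1 mul1r rmorphB rmorphM /= -/h qu0 mulr0 subr0.
by exists (h s) => /=; rewrite -/h mulrA key.
Qed.

Lemma scalar_normalized_trace (F : fieldType) (B : algType F) k
    (v : B -> 'rV[F]_k) (r : 'rV[F]_k -> B) :
  linear v -> scalar (normalized_trace v r).
Proof.
move=> lin_v c a b; rewrite /normalized_trace mulrCA -mulrDr; congr (_ * _).
rewrite -mxtraceZ -linearD /=; congr (\tr _); apply/matrixP => i j.
by rewrite !mxE mulrDl -scalerAl lin_v !mxE.
Qed.

(** For an annihilating polynomial [m] of least degree [k], the powers of [x] below [k] form a
    basis: division by [m] shows that they span, minimality that they are independent. *)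
Lemma finite_dimensional_horner (F : fieldType) (B : algType F) (x : B)
    (p : {poly F}) :
  p != 0 -> horner_alg x p = 0 -> (forall b, exists q, b = horner_alg x q) ->
  finite_dimensional B.
Proof.
move=> p0 px0 gen_x.
pose P k := `[< exists q : {poly F},
  [/\ q != 0, horner_alg x q = 0 & (size q).-1 = k] >].
have exP : exists k, P k by exists (size p).-1; apply/asboolP; exists p.
case: (ex_minnP exP) => k /asboolP[m [m0 mx0 sm]] min_k.
pose r (u : 'rV[F]_k) := horner_alg x (rVpoly u).
have size_m : size m = k.+1 by rewrite -sm prednK // size_poly_gt0.
have surj_r b : exists u, r u = b.
  have [q ->] := gen_x b; exists (poly_rV (q %% m)).
  rewrite /r poly_rV_K; last by rewrite -ltnS -size_m ltn_modp.
  by rewrite [in RHS](divp_eq q m) rmorphD rmorphM /= mx0 mulr0 add0r.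
have lin_r : linear r.
  move=> c u w; rewrite /r linearP rmorphD /= -mul_polyC rmorphM /=.
  by rewrite horner_algC mulr_algl.
have inj_r u : r u = 0 -> u = 0.
  move=> ru0; apply/eqP; apply: contraT => u0.
  have pu0 : rVpoly u != 0.
    by apply: contra u0 => /eqP pu0; rewrite -[u]rVpolyK pu0 linear0.
  have lek : (k <= (size (rVpoly u)).-1)%N.
    by apply: min_k; apply/asboolP; exists (rVpoly u).
  have := leq_trans (size_poly _ _ : (size (rVpoly u) <= k)%N) lek.
  by rewrite -ltnS prednK ?size_poly_gt0 // ltnn.
(* [v] is only a chosen section of [r]; injectivity of [r] makes it a two-sided inverse, and
   linearity is then inherited from [r]. *)
have [v vK] := choice surj_r.
have rK : cancel r v.
  move=> u; apply/eqP; rewrite -subr_eq0; apply/eqP/inj_r.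
  by rewrite addrC -scaleN1r lin_r vK scaleN1r addNr.
exists k, v, r; split=> // c a b.
by rewrite -{1}[a]vK -{1}[b]vK -lin_r rK.
Qed.

Lemma frobenius_separable (F : fieldType) (B : algType F) (x : B)
    (p : {poly F}) :
  [pchar F] =i pred0 -> separable_poly p -> horner_alg x p = 0 ->
  (forall b, exists q, b = horner_alg x q) ->
  forall k (v : B -> 'rV[F]_k) (r : 'rV[F]_k -> B),
    coordinates v r -> frobenius_algebra (normalized_trace v r).
Proof.
move=> char0 sep_p px0 gen_x k v r [lin_v vK rK].
split=> [||a tr_a0]; [|exact: scalar_normalized_trace|].
  exact: finite_dimensional_horner (separable_poly_neq0 sep_p) px0 gen_x.
have [q aE] := gen_x a; have [b] := separable_idempotent q sep_p px0.
rewrite -aE; set e := a * b => /= -[ee ea].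
have lin_r : linear r by move=> c u w; apply: (can_inj vK); rewrite lin_v !rK.
pose f y := v (e * r y).
have lin_f : linear f.
  by move=> c u w; rewrite /f lin_r mulrDr -scalerAr lin_v.
pose fL := GRing.isLinear.Build _ _ _ _ f lin_f.
pose g : {linear 'rV[F]_k -> 'rV[F]_k} := HB.pack f fL.
have gE u : u *m lin1_mx f = f u by exact: (mul_rV_lin1 g).
have EE : lin1_mx f *m lin1_mx f = lin1_mx f.
  apply/row_matrixP => i; rewrite !rowE mulmxA !gE.
  by rewrite /f vK mulrA ee.
have := tr_a0 b; rewrite /normalized_trace -/e -/f (mxtrace_idempotent EE).
have /pcharf0P char0' := char0.
move=> /eqP; rewrite mulf_eq0 invr_eq0 !char0' mxrank_eq0 => tr0.
suff e0 : e = 0 by rewrite -ea e0 mul0r.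
rewrite -[e]mulr1 -[1]vK; apply: (can_inj vK); rewrite -[LHS]/(f _) -gE.
have v0 : v 0 = 0.
  by rewrite -[0 in LHS](subrr 0) -scaleN1r addrC lin_v scaleN1r addNr.
(* The normalizing factor [k%:R^-1] vanishes when [k = 0]; in that case all coordinate vectors are
   equal. *)
rewrite v0; case/orP: tr0 => [/eqP k0|/eqP ->]; last by rewrite mulmx0.
by apply/matrixP => i [j ltj]; exfalso; move: ltj; rewrite k0.
Qed.

(** * Chebyshev polynomials *)

Lemma chebyshevSS (C : fieldType) n :
  chebyshev C n.+2 = 'X * chebyshev C n.+1 - chebyshev C n.
Proof. by []. Qed.

Lemma chebyshev_ind (P : nat -> Prop) :
  P 0%N -> P 1%N -> (forall n, P n -> P n.+1 -> P n.+2) -> forall n, P n.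
Proof.
move=> P0 P1 PS n; suff [] : P n /\ P n.+1 by [].
by elim: n => [|n [Pn PSn]]; split=> //; apply: PS.
Qed.

Lemma map_chebyshev (C F : fieldType) (f : {rmorphism C -> F}) n :
  map_poly f (chebyshev C n) = chebyshev F n.
Proof.
elim/chebyshev_ind: n => [||n IH0 IH1].
- by rewrite /= map_polyC /= rmorph_nat.
- by rewrite /= map_polyX.
- by rewrite !chebyshevSS rmorphB rmorphM /= map_polyX IH0 IH1.
Qed.

(** For odd [n] only odd powers survive, which places the threaded core in odd degree of the parity
    grading. *)
Lemma chebyshev_parity (C : fieldType) n k :
  odd (n + k) -> (chebyshev C n)`_k = 0.
Proof.
elim/chebyshev_ind: n k => [|| n IH0 IH1] k.
- by case: k => // k _; rewrite /= coefC.
- by rewrite /= coefX; case: k => [|[]].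
rewrite !addSn [odd _]negbK => nk.
rewrite chebyshevSS coefB coefXM IH0 // subr0.
by case: k nk => //= k; rewrite -addSnnS => /IH1.
Qed.

Lemma size_chebyshev (C : fieldType) n : (size (chebyshev C n) <= n.+1)%N.
Proof.
elim/chebyshev_ind: n => [||n IH0 IH1]; rewrite ?size_polyX //.
  by rewrite size_polyC leq_b1.
rewrite chebyshevSS (leq_trans (size_polyD _ _)) // geq_max size_polyN.
rewrite (leq_trans IH0) ?andbT; last by rewrite ltnW.
by rewrite (leq_trans (size_polyMleq _ _)) // size_polyX.
Qed.


(* [chebyshevU n] is the Chebyshev polynomial of the second kind of index
   [n - 1], that is (z^n - z^-n) / (z - z^-1) at z + z^-1. *)
Fixpoint chebyshevU (C : fieldType) (n : nat) : {poly C} :=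
  match n with
  | 0 => 0
  | 1 => 1
  | (m.+1 as k).+1 => 'X * chebyshevU C k - chebyshevU C m
  end.

Lemma chebyshevUSS (C : fieldType) n :
  chebyshevU C n.+2 = 'X * chebyshevU C n.+1 - chebyshevU C n.
Proof. by []. Qed.

(** With $x = z + z^{-1}$ and $d = z - z^{-1}$, one has $2z^n = T_n + d U_n$ and $d^2 = x^2 - 4$.
    The two identities are the components of multiplication by $z = (x + d)/2$. *)
Lemma chebyshevS (C : fieldType) n :
  2 * chebyshev C n.+1 = 'X * chebyshev C n + ('X^2 - 4) * chebyshevU C n /\
  2 * chebyshevU C n.+1 = 'X * chebyshevU C n + chebyshev C n.
Proof.
elim/chebyshev_ind: n => [||n [T0 U0] [T1 U1]].
- by split; rewrite /= ?polyCMn; ring.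
- by split; rewrite /= ?polyCMn; ring.
rewrite !(chebyshevSS _ n.+1) !(chebyshevUSS _ n.+1) (mulrBr 2) (mulrBr 2).
rewrite !(mulrCA 2 'X); split.
  have -> : 2 * chebyshev C n.+2 =
    'X * chebyshev C n.+1 + ('X^2 - 4) * chebyshevU C n.+1 by [].
  rewrite T0 chebyshevSS chebyshevUSS; ring.
rewrite U1 U0 chebyshevSS chebyshevUSS; ring.
Qed.

(** The left side is the product of $T_n + d U_n = 2z^n$ and its conjugate $2z^{-n}$. As
    [chebyshevS] gives doubled values, the induction step is proved up to a factor 4, which is then
    cancelled. *)
Lemma chebyshev_pell (C : fieldType) n :
  2 != 0 :> C ->
  chebyshev C n ^+ 2 - ('X^2 - 4) * chebyshevU C n ^+ 2 = 4.
Proof.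
move=> two; have four : (4 : {poly C}) != 0.
  by rewrite (natrM _ 2 2) mulf_neq0 // -polyC_natr polyC_eq0.
elim: n => [|n IH]; first by rewrite /= polyCMn; ring.
apply: (mulfI four); have [T U] := chebyshevS C n.
have -> : 4 * (chebyshev C n.+1 ^+ 2 - ('X^2 - 4) * chebyshevU C n.+1 ^+ 2)
  = (2 * chebyshev C n.+1) ^+ 2 - ('X^2 - 4) * (2 * chebyshevU C n.+1) ^+ 2.
  ring.
rewrite T U; transitivity
  (4 * (chebyshev C n ^+ 2 - ('X^2 - 4) * chebyshevU C n ^+ 2)).
  ring.
by rewrite IH.
Qed.

Lemma deriv_chebyshev (C : fieldType) n :
  2 != 0 :> C ->
  (chebyshev C n)^`() = n%:R * chebyshevU C n.
Proof.
move=> two; have two' : (2 : {poly C}) != 0 by rewrite -polyC_natr polyC_eq0.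
(* By [chebyshevS], the derivative of $T_{n+1}$ involves that of $U_n$, so both derivatives are
   computed in one induction. *)
suff [] : (chebyshev C n)^`() = n%:R * chebyshevU C n /\
  ('X^2 - 4) * (chebyshevU C n)^`() =
    n%:R * chebyshev C n - 'X * chebyshevU C n by [].
elim: n => [|n [dT dU]]; first by rewrite /= derivC linear0; split; ring.
have [T U] := chebyshevS C n.
have d2 (p : {poly C}) : (2 * p)^`() = 2 * p^`() by rewrite !mulr_natl derivMn.
have d4 : ('X^2 - 4 : {poly C})^`() = 2 * 'X.
  by rewrite derivB derivXn -(polyC_natr C 4) derivC subr0 mulr_natl.
split; apply: (mulfI two').
  rewrite -d2 T derivD !derivM derivX d4 dT dU (mulrCA 2 n.+1%:R) U -natr1.
  ring.
rewrite (mulrCA 2 ('X^2 - 4)) -d2 U derivD !derivM derivX dT.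
have -> : ('X^2 - 4) * (1 * chebyshevU C n + 'X * (chebyshevU C n)^`()
    + n%:R * chebyshevU C n) =
  ('X^2 - 4) * chebyshevU C n + 'X * (('X^2 - 4) * (chebyshevU C n)^`())
    + n%:R * ('X^2 - 4) * chebyshevU C n by ring.
rewrite dU (mulrBr 2) !(mulrCA 2) T U -natr1; ring.
Qed.

(** Subtracting $t^2$ from the Pell equation gives $(T_n + t)(T_n - t) - (x^2 - 4) U_n^2 = 4 - t^2$.
    Since $T_n' = n U_n$, this is a Bezout relation with nonzero constant value. *)
Lemma separable_chebyshev (C : fieldType) n (t : C) :
  [pchar C] =i pred0 -> (0 < n)%N -> t ^+ 2 != 4 ->
  separable_poly (chebyshev C n - t%:P).
Proof.
move=> /pcharf0P char0 n0 t4.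
have two : 2 != 0 :> C by rewrite char0.
have nn : n%:R != 0 :> C by rewrite char0 -lt0n.
rewrite separable_poly.unlock derivB derivC subr0 deriv_chebyshev //.
have d0 : 4 - t ^+ 2 != 0 by rewrite subr_eq0 eq_sym.
apply/Bezout_coprimepP.
exists (chebyshev C n + t%:P,
        - ('X^2 - 4) * chebyshevU C n * (n%:R^-1)%:P) => /=.
have -> : (chebyshev C n + t%:P) * (chebyshev C n - t%:P) +
  - ('X^2 - 4) * chebyshevU C n * (n%:R^-1)%:P * (n%:R * chebyshevU C n)
  = (4 - t ^+ 2)%:P; last by rewrite -size_poly_eq1 size_polyC d0.
have nV : (n%:R^-1)%:P * n%:R = 1 :> {poly C}.
  by rewrite -polyC_natr -polyCM mulVf.
transitivity (chebyshev C n ^+ 2 - t%:P ^+ 2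
  - ('X^2 - 4) * chebyshevU C n ^+ 2 * ((n%:R^-1)%:P * n%:R)); first by ring.
by rewrite nV mulr1 addrAC chebyshev_pell // polyCB polyC_natr polyC_exp.
Qed.

(** * Generation of the skein algebra of the annulus by the core *)

(** The empty word on [k] strands closes up to [k] parallel copies of the core, which represent
    $x^k$. *)
Definition parallel (k : nat) : diagram := @Diagram (k, [::]) (eqxx _).

Lemma diagram_inj (D E : diagram) : cut D = cut E -> D = E.
Proof. exact: val_inj. Qed.

Definition is_crossing (t : tile) : bool :=
  if t.1 is (Over | Under) then true else false.

(** On a closed word, where [m = n], there are as many cups as caps. *)
Lemma run_count n w m : run n w = Some m ->
  (m + (count (fun t : tile => t.1 == Cap) w).*2 =
   n + (count (fun t : tile => t.1 == Cup) w).*2)%N.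
Proof.
elim: w n => [|[p i] w IH] n /=; first by case=> ->.
rewrite /step /=; case: ifP => //= h /IH {IH}.
by case: p h => /= h; lia.
Qed.

(* Termination measure: it drops when a cup is slid past a far away cap that
   follows it. *)
Fixpoint strand_sum (n : nat) (w : word) : nat :=
  if w is t :: w' then (n + strand_sum (odflt 0 (step t n)) w')%N else 0%N.

Lemma strand_sum_cat n w1 w2 m : run n w1 = Some m ->
  strand_sum n (w1 ++ w2) = (strand_sum n w1 + strand_sum m w2)%N.
Proof.
elim: w1 n => [|t w1 IH] n /=; first by case=> ->.
by case: (step t n) => [k|] //= /IH ->; rewrite addnA.
Qed.

Lemma has_split (T : eqType) (a : pred T) (s : seq T) :
  has a s -> exists u x v, s = u ++ x :: v /\ a x.
Proof. by case/hasP=> x /path.splitPr[u v] ax; exists u, x, v. Qed.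

Lemma cup_before_cap i w :
  ~~ has is_crossing w -> has (fun t : tile => t.1 == Cap) w ->
  exists w1 j k w2, (Cup, i) :: w = w1 ++ [:: (Cup, j); (Cap, k)] ++ w2.
Proof.
elim: w i => [//|[[] j] w IH] i //= nx cap.
  have [w1 [k [l [w2 ->]]]] := IH j nx cap.
  by exists ((Cup, i) :: w1), k, l, w2.
by exists [::], i, j, w.
Qed.

Lemma closed_replace n w1 u w2 v p q :
  is_closed (n, w1 ++ u ++ w2) -> run n w1 = Some p ->
  run p u = Some q -> run p v = Some q -> is_closed (n, w1 ++ v ++ w2).
Proof.
move=> cl nw1 pu pv; move: cl.
by rewrite /is_closed /= !(run_cat n) nw1 /= !(run_cat p) pu pv.
Qed.

Lemma closed_prefix n w1 w2 :
  is_closed (n, w1 ++ w2) -> exists2 p, run n w1 = Some p & run p w2 = Some n.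
Proof.
rewrite /is_closed /= run_cat; case: (run n w1) => [p|] //= /eqP pw2.
by exists p.
Qed.

Lemma link_class_isotopic (C : fieldType) (A : C) D E :
  isotopic D E -> link_class A D = link_class A E.
Proof. by move=> DE; apply/skein_classP/null_isotopic. Qed.

Lemma skein_scaleE (C : fieldType) (A : C) c g :
  c *: skein_class A g = skein_class A (c *: g).
Proof. exact: skein_classZ. Qed.

Lemma skein_mulE (C : fieldType) (A : C) g h :
  skein_class A g * skein_class A h = skein_class A (g * h).
Proof. exact: skein_classM. Qed.

Lemma link_class_circle (C : fieldType) (A : C) n w1 i w2 D E :
  cut D = (n, w1 ++ [:: (Cup, i); (Cap, i)] ++ w2) -> cut E = (n, w1 ++ w2) ->
  link_class A D = (- (A ^+ 2 + A ^- 2)) *: link_class A E.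
Proof.
move=> DE ED; rewrite /link_class skein_scaleE; apply/skein_classP.
by rewrite scaleNr opprK; apply: null_circle DE ED.
Qed.

Lemma link_class_skein (C : fieldType) (A : C) a b D D0 Doo :
  skein_null A (<< D >> - (a *: << D0 >> + b *: << Doo >>)) ->
  link_class A D = a *: link_class A D0 + b *: link_class A Doo.
Proof.
rewrite /link_class !skein_scaleE -skein_classD.
by move=> h; apply/skein_classP.
Qed.

(** Turning the cutting ray brings a cup to the front; the first cap is then immediately preceded by
    a cup. That pair is either removed or exchanged, and the strand sum plus the length decreases in
    each case. *)
Lemma crossingless_parallel (C : fieldType) (A : C) (D : diagram) :
  ~~ has is_crossing (cut D).2 ->
  exists c k, link_class A D = c *: link_class A (parallel k).
Proof.
have [M] := ubnP (strand_sum (cut D).1 (cut D).2 + size (cut D).2).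
elim: M D => // M IH [[n w] clD] /=; rewrite ltnS => leM nx.
have [w0|wn0] := eqVneq w [::].
  subst w; exists 1, n; rewrite scale1r; congr link_class.
  exact: diagram_inj.
have cnt := run_count (eqP clD); rewrite /= in cnt.
(* Without cups there are no caps either, and a crossingless word would be empty. *)
have cup : has (fun t : tile => t.1 == Cup) w.
  apply: contraT; rewrite has_count -leqNgt leqn0 => /eqP cup0.
  have : has (fun t : tile => t.1 == Cap) w = false by rewrite has_count; lia.
  have := cup0; move/eqP; rewrite -leqn0 leqNgt -has_count.
  by case: w wn0 nx {IH leM cnt cup0 clD} => [|[[] j] w].
have cap : has (fun t : tile => t.1 == Cap) w.
  by move: cup; rewrite !has_count; lia.
have [u [i [v wE]]] : exists u i v, w = u ++ (Cup, i) :: v.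
  have [u [[p i] [v [-> /= /eqP ->]]]] := has_split cup.
  by exists u, i, v.
subst w; have [m nu mv] := closed_prefix clD.
have clE : is_closed (m, ((Cup, i) :: v) ++ u).
  by rewrite /is_closed run_cat mv /= nu.
have -> : link_class A (Diagram clD) = link_class A (Diagram clE).
  exact/link_class_isotopic/(isotopic_turn nu).
have leE : (strand_sum m (((Cup, i) :: v) ++ u) +
            size (((Cup, i) :: v) ++ u) <= M)%N.
  rewrite (strand_sum_cat _ mv) size_cat addnC (addnC (strand_sum _ _)).
  rewrite (addnC (size _)) addnC.
  by move: leM; rewrite (strand_sum_cat _ nu) size_cat.
have nxE : ~~ has is_crossing (((Cup, i) :: v) ++ u).
  by move: nx; rewrite !has_cat orbC.
have capE : has (fun t : tile => t.1 == Cap) (v ++ u).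
  by move: cap; rewrite !has_cat /= orbC.
have [w1 [j [k [w2 wE]]]] := @cup_before_cap i (v ++ u) nxE capE.
move: clE leE nxE; rewrite cat_cons wE => clE leE nxE.
clear clD leM nx wn0 cnt cup cap capE wE mv nu.
have [p mw1 pw2] := closed_prefix clE.
have [jp kp] : (j <= p)%N /\ (k <= p)%N.
  move: pw2; rewrite /= /step /= addn0; case: ifP => //= jp.
  by case: ifP => //= kp _; lia.
have pE : run p [:: (Cup, j); (Cap, k)] = Some p.
  rewrite /= /step /= !addn0 jp /=; case: ifP => /= kp'; last lia.
  by congr Some; lia.
have sumE : strand_sum p [:: (Cup, j); (Cap, k)] = (p + p.+2)%N.
  by rewrite /= /step /= !addn0 jp /=; lia.
have nx1 x : ~~ has is_crossing x -> ~~ has is_crossing (w1 ++ x ++ w2).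
  by move: nxE; rewrite !has_cat /= !negb_or => /andP[-> ->]; rewrite andbT.
rewrite (strand_sum_cat _ mw1) (strand_sum_cat _ pE) sumE !size_cat /= in leE.
(* The bound is what the pair itself contributes to the measure: its strand sum [p + p.+2] and its
   two tiles. *)
have reduce x c : run p x = Some p ->
    (strand_sum p x + size x < (p + p.+2).+2)%N -> ~~ has is_crossing x ->
    (forall E, cut E = (m, w1 ++ x ++ w2) ->
       link_class A (Diagram clE) = c *: link_class A E) ->
    exists c k, link_class A (Diagram clE) = c *: link_class A (parallel k).
  move=> px ltx nxx DE; have clx := closed_replace clE mw1 pE px.
  have [||d [l dE]] := IH (Diagram clx); rewrite ?nx1 //=.
    rewrite (strand_sum_cat _ mw1) (strand_sum_cat _ px) !size_cat.
    move: leE ltx; move: (strand_sum _ w1) (strand_sum _ w2) (strand_sum _ x).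
    by move: (size w1) (size w2) (size x); lia.
  by exists (c * d), l; rewrite -scalerA -dE; apply: DE.
(* Equal positions bound a circle and neighbouring ones form a zigzag. Otherwise the pieces are far
   apart, and exchanging them lowers the number of strands between them from [p + 2] to [p - 2]. *)
have [jk|jk|jk] := ltngtP j k.
- have [k1|k1] := eqVneq k j.+1.
    apply: (reduce [::] 1) => //= E EE; rewrite scale1r; subst k.
    exact/link_class_isotopic/(isotopic_local (move_zigzag_l j)).
  have [d kE] : exists d, k = (j + 2 + d)%N by exists (k - (j + 2))%N; lia.
  subst k.
  (* The [0] is [fan_in Cup], kept so that the word has the shape of [move_far]. *)
  have s1 : step (Cap, j + 0 + d)%N p = Some (p - 2)%N.
    by rewrite /step /=; case: ifP => h; [congr Some; lia | lia].
  have s2 : step (Cup, j) (p - 2) = Some p.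
    by rewrite /step /=; case: ifP => h; [congr Some; lia | lia].
  apply: (reduce [:: (Cap, j + 0 + d)%N; (Cup, j)] 1) => //.
  + by rewrite /= s1 /= s2.
  + by rewrite /= s1 /=; lia.
  + move=> E EE; rewrite scale1r; apply/link_class_isotopic/isotopic_sym.
    by apply: (isotopic_local (move_far Cup Cap j d) EE).
- have [k1|k1] := eqVneq j k.+1.
    apply: (reduce [::] 1) => //= E EE; rewrite scale1r; subst j.
    exact/link_class_isotopic/(isotopic_local (move_zigzag_r k)).
  have [d kE] : exists d, j = (k + 2 + d)%N by exists (j - (k + 2))%N; lia.
  subst j.
  have s1 : step (Cap, k)%N p = Some (p - 2)%N.
    by rewrite /step /=; case: ifP => h; [congr Some; lia | lia].
  have s2 : step (Cup, k + 0 + d)%N (p - 2) = Some p.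
    by rewrite /step /=; case: ifP => h; [congr Some; lia | lia].
  apply: (reduce [:: (Cap, k); (Cup, k + 0 + d)%N] 1) => //.
  + by rewrite /= s1 /= s2.
  + by rewrite /= s1 /=; lia.
  + move=> E EE; rewrite scale1r; apply: link_class_isotopic.
    by apply: (isotopic_local (move_far Cap Cup k d) _ EE).
- subst k; apply: (reduce [::] (- (A ^+ 2 + A ^- 2))) => //= E EE.
  exact: (link_class_circle A (erefl : cut (Diagram clE) = _)).
Qed.

(** The sum has the form used in [chi], so that [chi] is by conversion the image of
    [malg_ext (thread A N)]. *)
Definition malg_ext (C : fieldType) (V : lmodType C) (f : diagram -> V)
    (g : {malg C[diagram]}) : V :=
  \sum_(D <- msupp g) g@_D *: f D.

Lemma malg_ext_sub (C : fieldType) (V : lmodType C) (f : diagram -> V)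
    (g : {malg C[diagram]}) (d : {fset diagram}) :
  (msupp g `<=` d)%fset -> malg_ext f g = \sum_(D <- d) g@_D *: f D.
Proof.
move=> gd; apply: big_fset_incl => // D _ /mcoeff_outdom ->.
exact: scale0r.
Qed.

Lemma malg_ext_linear (C : fieldType) (V : lmodType C) (f : diagram -> V) :
  linear (malg_ext f).
Proof.
move=> c g h; pose d := (msupp g `|` msupp h `|` msupp (c *: g + h))%fset.
rewrite !(@malg_ext_sub _ _ _ _ d) ?fsubsetUr //; first last.
- by rewrite /d -fsetUA fsubsetUl.
- by rewrite /d fsetUAC fsubsetUr.
rewrite scaler_sumr -big_split; apply: eq_bigr => D _ /=.
by rewrite mcoeffD mcoeffZ scalerDl scalerA.
Qed.

HB.instance Definition _ (C : fieldType) (V : lmodType C) (f : diagram -> V) :=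
  GRing.isLinear.Build C {malg C[diagram]} V _ (malg_ext f) (malg_ext_linear f).

Lemma malg_extU (C : fieldType) (V : lmodType C) (f : diagram -> V) D :
  malg_ext f << D >> = f D.
Proof.
rewrite (@malg_ext_sub _ _ _ _ [fset D]%fset) ?msuppU_le //.
by rewrite big_seq_fset1 mcoeffUU scale1r.
Qed.

Lemma skein_class_ext (C : fieldType) (A : C) g :
  skein_class A g = malg_ext (link_class A) g.
Proof.
have class0 : skein_class A 0 = 0 by exact: raddf0.
rewrite {1}[g]monalgE (big_morph _ (skein_classD A) class0).
by apply: eq_bigr => D _; rewrite malgUZ -skein_scaleE.
Qed.

(** Both smoothings of a crossing have one crossing fewer, so induction on the number of crossings
    reduces to crossingless diagrams. *)
Lemma skein_parallel_ind (C : fieldType) (A : C) (P : skein A -> Prop) :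
  (forall x y, P x -> P y -> P (x + y)) -> (forall c x, P x -> P (c *: x)) ->
  (forall k, P (link_class A (parallel k))) -> forall x, P x.
Proof.
move=> PD PZ Pk.
have PL D : P (link_class A D).
  have [M] := ubnP (count is_crossing (cut D).2).
  elim: M D => // M IH D; rewrite ltnS => leM.
  have [xs|nx] := boolP (has is_crossing (cut D).2); last first.
    by have [c [k ->]] := crossingless_parallel A nx; apply/PZ.
  case: D xs leM => -[n w] clD /= /has_split[w1 [[p i] [w2 [wE px]]]].
  subst w; rewrite count_cat /= px => leM.
  have [m nw1 mw2] := closed_prefix clD.
  have im : (i + 2 <= m)%N.
    by move: mw2 px; case: p {clD leM} => //=; rewrite /step /=; case: ifP.
  have mp : run m [:: (p, i)] = Some m.
    case: p px {clD leM mw2} => //= _; rewrite /step /= im /=; congr Some; lia.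
  have mc : run m [:: (Cap, i); (Cup, i)] = Some m.
    by rewrite /= /step /= im /=; case: ifP => h; [congr Some; lia|lia].
  have cl0 : is_closed (n, w1 ++ [::] ++ w2).
    exact: (@closed_replace _ _ [:: (p, i)] _ _ _ _ clD nw1 mp).
  have cl1 := @closed_replace _ _ [:: (p, i)] _ _ _ _ clD nw1 mp mc.
  have P0 : P (link_class A (Diagram cl0)).
    by apply: IH; rewrite /= count_cat; lia.
  have P1 : P (link_class A (Diagram cl1)).
    by apply: IH; rewrite /= count_cat /=; lia.
  case: p px clD {mw2 mp leM} => // _ clD.
    rewrite (@link_class_skein _ A A A^-1 _ (Diagram cl0) (Diagram cl1)).
      by apply: PD; apply: PZ.
    exact: (@null_over _ A n w1 i w2).
  rewrite (@link_class_skein _ A A A^-1 _ (Diagram cl1) (Diagram cl0)).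
    by apply: PD; apply: PZ.
  exact: (@null_under _ A n w1 i w2).
move=> x; have [g <-] := skein_class_surj x; rewrite skein_class_ext.
apply: big_ind => [||D _]; [|exact: PD|exact: PZ].
by rewrite -(scale0r (link_class A (parallel 0))); apply: PZ.
Qed.

(** * Threading and the parity grading *)

Lemma skein_scaleMl (C : fieldType) (A : C) c (x y : skein A) :
  (c *: x) * y = c *: (x * y).
Proof.
have [g <-] := skein_class_surj x; have [h <-] := skein_class_surj y.
rewrite skein_scaleE !skein_mulE skein_scaleE.
by rewrite -scalerAl.
Qed.

Lemma link_class_parallel (C : fieldType) (A : C) k :
  link_class A (parallel k) = link_class A (parallel 1) ^+ k.
Proof.
elim: k => [|k IH]; first by rewrite expr0; congr skein_class.
rewrite exprSr -IH /link_class skein_mulE malgUM.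
congr (skein_class A << _ >>); apply: diagram_inj.
by rewrite /= /juxt_cut /= addn1.
Qed.

(** Without arcs there is a single coloring, with an empty product of coefficients. This puts the
    scalars in [chi]. *)
Lemma thread_empty (C : fieldType) (A : C) N : thread A N empty_link = 1.
Proof.
have no_arc : 'I_(arcs empty_link) -> False by case.
pose c0 := [ffun _ : 'I_(arcs empty_link) => ord0 : 'I_N.+1].
have all_c0 c : c = c0 by apply/ffunP => a; case: (no_arc a).
have col c : component_coloring (c : {ffun 'I_(arcs empty_link) -> 'I_N.+1}).
  by apply/forallP => a; case: (no_arc a).
rewrite /thread (big_pred1 c0) => [|c]; last first.
  by rewrite col /= (all_c0 c) eqxx.
rewrite big1 ?scale1r => [|a]; last by case: (no_arc a).
rewrite /link_class; congr (skein_class A << _ >>); apply: diagram_inj.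
by rewrite cut_cabling.
Qed.

(** The core has one arc, so a coloring is a single number [k], and its cabling is [parallel k]. By
    [link_class_parallel] the right side is $T_N(x)$. *)
Lemma thread_core (C : fieldType) (A : C) N :
  thread A N (parallel 1) =
  \sum_(k < N.+1) (chebyshev C N)`_k *: link_class A (parallel k).
Proof.
pose i0 : 'I_(arcs (parallel 1)) := @ord0 0.
pose const (k : 'I_N.+1) := [ffun _ : 'I_(arcs (parallel 1)) => k].
rewrite /thread (reindex const) /=; last first.
  exists (fun c => c i0) => [k _|c _]; first by rewrite ffunE.
  by apply/ffunP => a; rewrite ffunE (ord1 a).
have col k : component_coloring (const k).
  by apply/forallP => a; apply/forallP => b; rewrite !ffunE eqxx implybT.
apply: eq_big => [k|k _]; first exact: col.
congr (_ *: link_class A _).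
  rewrite (big_pred1 i0) ?ffunE // => a.
  have -> : a = i0 by exact: ord1.
  by rewrite /= eqxx; apply/eqP; exact: ord1.
apply: diagram_inj; rewrite cut_cabling ?col // /cable_cut /=.
by rewrite /copies insubT //= ffunE addn0.
Qed.

Lemma chi_thread (C : fieldType) (A : C) N D : chi N (thread A N D).
Proof. by exists << D >>; rewrite -[RHS]/(malg_ext _ _) malg_extU. Qed.

Lemma chi_linear (C : fieldType) (A : C) N c (x y : skein A) :
  chi N x -> chi N y -> chi N (c *: x + y).
Proof.
move=> [g ->] [h ->]; exists (c *: g + h).
rewrite -[RHS]/(malg_ext (thread A N) (c *: g + h)).
by rewrite linearP.
Qed.

Lemma chi_scalar (C : fieldType) (A : C) N c : chi N (c *: (1 : skein A)).
Proof.
exists (c *: << empty_link >>); rewrite -[RHS]/(malg_ext (thread A N) _).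
by rewrite linearZ /= malg_extU thread_empty.
Qed.

(** Extended linearly, this is the involution attached to the parity grading. *)
Definition link_sign (C : fieldType) (A : C) (D : diagram) : skein A :=
  (-1) ^+ (cut D).1 *: link_class A D.

Lemma step_parity t n m : step t n = Some m -> odd m = odd n.
Proof.
case: t => p i; rewrite /step /=; case: ifP => // h [<-].
by case: p h => /= h; lia.
Qed.

Lemma run_parity w n m : run n w = Some m -> odd m = odd n.
Proof.
elim: w n => [|t w IH] n /=; first by case=> ->.
by case E: (step t n) => [k|] //= /IH ->; apply: step_parity E.
Qed.

Lemma isotopic_parity D E : isotopic D E -> odd (cut D).1 = odd (cut E).1.
Proof.
elim=> {D E} [D E n w1 u v w2 _ -> -> //|D E n m w1 w2 nm -> -> /=|//|//|].
  by rewrite (run_parity nm).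
by move=> D E G _ -> _ ->.
Qed.

(** The sign twist descends to the skein algebra: isotopies preserve the parity of the cut, and the
    other relations keep the number of strands there. *)
Lemma skein_null_sign (C : fieldType) (A : C) g :
  skein_null A g -> malg_ext (link_sign A) g = 0.
Proof.
elim=> {g} [D E DE|n w1 i w2 D D0 Doo DE D0E DooE|n w1 i w2 D D0 Doo DE D0E DooE
           |n w1 i w2 D E DE EE| |g h _ g0 _ h0|c g _ g0].
- rewrite linearB /= !malg_extU /link_sign (link_class_isotopic A DE).
  by rewrite -signr_odd (isotopic_parity DE) signr_odd subrr.
- have := null_over A DE D0E DooE => /link_class_skein E.
  rewrite linearB linearD !linearZ /= !malg_extU /link_sign E DE D0E DooE /=.
  by rewrite !(scalerA, scalerDr) ![_ * (-1) ^+ _]mulrC subrr.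
- have := null_under A DE D0E DooE => /link_class_skein E.
  rewrite linearB linearD !linearZ /= !malg_extU /link_sign E DE D0E DooE /=.
  by rewrite !(scalerA, scalerDr) ![_ * (-1) ^+ _]mulrC subrr.
- rewrite linearD !linearZ /= !malg_extU /link_sign.
  rewrite (link_class_circle A DE EE) DE EE /=.
  by rewrite !scalerA mulrN mulrC scaleNr addNr.
- exact: linear0.
- by rewrite linearD /= g0 h0 addr0.
- by rewrite linearZ /= g0 scaler0.
Qed.

(** The sign twist negates $T_N(x)$ and fixes constants. Applied to $T_N(x) - c = 0$ it gives $-2c =
    0$ in the skein algebra, where $2c$ is an invertible scalar. *)
Lemma thread_core_neq_scalar (C : fieldType) (A : C) N c :
  odd N -> 2 != 0 :> C -> c != 0 ->
  thread A N (parallel 1) = c *: (1 : skein A) -> (1 : skein A) = 0.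
Proof.
move=> oddN two c0; rewrite thread_core => TE.
pose g : {malg C[diagram]} :=
  \sum_(k < N.+1) (chebyshev C N)`_k *: << parallel k >>.
have gE (f : diagram -> skein A) :
    malg_ext f g = \sum_(k < N.+1) (chebyshev C N)`_k *: f (parallel k).
  rewrite /g linear_sum; apply: eq_bigr => k _.
  by rewrite linearZ /= malg_extU.
have class1 : link_class A (parallel 0) = 1 by rewrite link_class_parallel.
have null : skein_null A (- c *: << parallel 0 >> + g).
  rewrite -[_ + g]subr0; apply/skein_classP.
  rewrite skein_class_ext linearP /= gE TE malg_extU.
  rewrite class1 scaleNr addNr; symmetry; exact: raddf0.
have := skein_null_sign null.
rewrite linearP /= gE malg_extU /link_sign expr0 scale1r class1.
rewrite [X in _ + X](_ : _ = - (c *: (1 : skein A))).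
  rewrite -scaleNr -scalerDl -opprD -mulr2n -mulr_natl scaleNr => /eqP.
  rewrite oppr_eq0 => /eqP cc0.
  by rewrite -[LHS](scalerK (mulf_neq0 two c0)) cc0 scaler0.
rewrite -TE -sumrN; apply: eq_bigr => k _; rewrite /= scalerA.
have [ek|ok] := boolP (odd k).
  by rewrite -signr_odd ek expr1 mulrN1 scaleNr.
by rewrite chebyshev_parity ?mul0r ?scale0r ?oppr0 // oddD oddN (negbTE ok).
Qed.

(** * The localized skein algebra over the function field *)

Theorem localization_frobenius (C : fieldType) (A : C) N (F : fieldType)
    (B : algType F) (phi : {rmorphism skein A -> B}) (psi : skein A -> F) :
  [pchar C] =i pred0 -> odd N ->
  is_localization (@chi_nonzero _ A N) phi ->
  is_fraction_field (@chi _ A N) psi ->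
  (forall x, chi N x -> phi x = (psi x)%:A) ->
  finite_dimensional B /\
  forall (k : nat) (v : B -> 'rV[F]_k) (r : 'rV[F]_k -> B),
    coordinates v r -> frobenius_algebra (normalized_trace v r).
Proof.
move=> charC oddN [_ loc_frac _] [psi1 psiD psiM psi_inj _] compat.
pose s c := c *: (1 : skein A).
have chi_s c : chi N (s c) by exact: chi_scalar.
have sM c x : c *: x = s c * x by rewrite skein_scaleMl mul1r.
have psi0 : psi 0 = 0.
  have := psiD _ _ (chi_s 0) (chi_s 0); rewrite /s scale0r addr0.
  by move/eqP; rewrite addrC -subr_eq subrr eq_sym => /eqP.
have one_neq0 : (1 : skein A) <> 0.
  by move=> one0; have := oner_neq0 F; rewrite -psi1 one0 psi0 eqxx.
(* [psi] is controlled on [chi] only; since [chi] contains the scalars, it restricts to a field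
   embedding of [C] in [F], which carries characteristic 0 over to [F]. *)
pose iota c := psi (s c).
have iotaD : nmod_morphism iota.
  split=> [|a b]; first by rewrite /iota /s scale0r.
  by rewrite /iota /s scalerDl psiD //; apply: chi_s.
have iotaM : monoid_morphism iota.
  split=> [|a b]; first by rewrite /iota /s scale1r.
  by rewrite /iota /s -scalerA sM psiM //; apply: chi_s.
pose iD := GRing.isNmodMorphism.Build _ _ iota iotaD.
pose iM := GRing.isMonoidMorphism.Build _ _ iota iotaM.
pose f : {rmorphism C -> F} := HB.pack iota iD iM.
have charF : [pchar F] =i pred0 by move=> p; rewrite (fmorph_pchar f) charC.
pose x := phi (link_class A (parallel 1)).
pose t := psi (thread A N (parallel 1)).
have phiZ c y : phi (c *: y) = iota c *: phi y.
  by rewrite sM rmorphM compat // mulr_algl.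
have gen_x b : exists q, b = horner_alg x q.
  (* The denominator [d] acts on [B] as the nonzero scalar [psi d], so it suffices to express the
     numerator [phi y] as a polynomial in [x]. *)
  have [y [d [[chi_d d0] db]]] := loc_frac b.
  have [q yq] : exists q, phi y = horner_alg x q.
    elim/skein_parallel_ind: y {db} => [y z [p yp] [q zq]|c y [p yp]|k].
    - by exists (p + q); rewrite !rmorphD yp zq.
    - exists ((iota c)%:P * p).
      by rewrite phiZ yp rmorphM /= horner_algC mulr_algl.
    - by exists 'X^k; rewrite link_class_parallel !rmorphXn /= horner_algX.
  have pd0 : psi d != 0 by apply/eqP => /(psi_inj _ chi_d).
  exists ((psi d)^-1%:P * q); rewrite rmorphM /= horner_algC -yq -db.
  by rewrite compat // !mulr_algl scalerA mulVf // scale1r.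
have xt : horner_alg x (chebyshev F N - t%:P) = 0.
  rewrite rmorphB /= horner_algC -compat; last exact: chi_thread.
  rewrite thread_core rmorph_sum /= -(map_chebyshev f).
  (* Cutting the polynomial at degree [N] matches its terms with those of [thread_core]. *)
  have -> : map_poly f (chebyshev C N) = \poly_(k < N.+1) f (chebyshev C N)`_k.
    apply/polyP => k; rewrite coef_map coef_poly; case: ltnP => //= Nk.
    have -> : (chebyshev C N)`_k = 0.
      exact/nth_default/(leq_trans (size_chebyshev C N)).
    exact: (rmorph0 f).
  rewrite poly_def rmorph_sum /= -sumrB big1 // => k _.
  rewrite -mul_polyC rmorphM /= horner_algC rmorphXn /= horner_algX phiZ.
  by rewrite link_class_parallel rmorphXn /= mulr_algl subrr.
have two0 : 2 != 0 :> C by have /pcharf0P -> := charC.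
have t4 : t ^+ 2 != 4.
  (* The values 2 and -2 come from scalars of [C], so injectivity of [psi] on [chi] would turn
     [t = f e] into an equality between the threaded core and a nonzero scalar in the skein
     algebra. *)
  have sg e : e = 2 \/ e = -2 -> t <> f e.
    move=> e2 te; have e0 : e != 0.
      by case: e2 => ->; rewrite ?oppr_eq0.
    apply/one_neq0/(thread_core_neq_scalar oddN two0 e0)/eqP.
    rewrite -subr_eq0 -scaleNr addrC -/(s (- e)); apply/eqP/psi_inj.
      apply: chi_linear; last exact: chi_thread.
      by rewrite -[1]scale1r; apply: chi_s.
    rewrite psiD; [|exact: chi_s|exact: chi_thread].
    by rewrite -/t te -[psi _]/(f (- e)) rmorphN addNr.
  apply/eqP => t4; have : (t - 2) * (t + 2) = t ^+ 2 - 4 by ring.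
  rewrite t4 subrr.
  move/eqP; rewrite mulf_eq0 subr_eq0 addr_eq0 => /orP[] /eqP tE.
    by apply: (sg 2); [left | rewrite rmorph_nat].
  by apply: (sg (-2)); [right | rewrite rmorphN rmorph_nat].
have sep := separable_chebyshev charF (odd_gt0 oddN) t4.
split; last exact: frobenius_separable sep xt gen_x.
exact: finite_dimensional_horner (separable_poly_neq0 sep) xt gen_x.
Qed.

Theorem theorem3p7 (R : realType) (N : nat) (N_ge3 : (3 <= N)%N) (N_odd : odd N)
    (F : fieldType) (B : algType F)
    (phi : {rmorphism skein (skein_root R N) -> B})
    (psi : skein (skein_root R N) -> F)
    (locK : is_localization (@chi_nonzero _ (skein_root R N) N) phi)
    (fracX : is_fraction_field (@chi _ (skein_root R N) N) psi)
    (compat : forall x, chi N x -> phi x = (psi x)%:A) :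
  finite_dimensional B /\
  forall (k : nat) (v : B -> 'rV[F]_k) (r : 'rV[F]_k -> B),
    coordinates v r -> frobenius_algebra (normalized_trace v r).
Proof.
(* [R[i]] is a numeric field, hence of characteristic 0. *)
exact: localization_frobenius (@Num.Theory.pchar_num _) N_odd locK fracX compat.
Qed.
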